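(* Let $N\geq2$ be an even integer. Then the differential operators $$\sum_{j=0}^{p}w_j(z)\cdot\partial^j,\qquad w_j\in\mathcal{O}(\mathbb{C}),$$ of arbitrary orders $p\geq0$ compose a homotopy $N$-Lie algebra (over $\mathbb{C}$) with respect to the bracket $$[A_1,\dots,A_N]=\sum_{\sigma\in S_N}(-1)^\sigma A_{\sigma(1)}\circ\dots\circ A_{\sigma(N)}.$$
   Context: $\mathcal{O}(\mathbb{C})$ is the commutative algebra of Laurent series over $\mathbb{C}$ in the coordinate $z$ (with finitely many negative powers, so that products are defined), $\partial=d/dz$, and the differential operators act on $\mathcal{O}(\mathbb{C})$; $\circ$ is composition of operators and $(-1)^\sigma$ is the sign of $\sigma$. A vector space $V$ with an $N$-linear skew-symmetric bracket $\Delta:\bigwedge^N V\to V$ is a homotopy $N$-Lie algebra (Schlessinger–Stasheff $N$-algebra) if the $N$-Jacobi identity holds: for all $a_1,\dots,a_{2N-1}\in V$, $$\sum_{\sigma\in S^N_{2N-1}}(-1)^\sigma\Delta\bigl(\Delta(a_{\sigma(1)},\ldots,a_{\sigma(N)}),a_{\sigma(N+1)},\ldots,a_{\sigma(2N-1)}\bigr)=0,$$ where $S^N_{2N-1}$ is the set of permutations $\sigma\in S_{2N-1}$ with $\sigma(1)<\dots<\sigma(N)$ and $\sigma(N+1)<\dots<\sigma(2N-1)$. *)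

(* Defs.v *)
From HB Require Import structures.
From mathcomp Require Import all_boot all_order all_fingroup all_algebra.
From mathcomp Require Import zify.
From mathcomp Require Import boolp classical_sets functions cardinality fsbigop.
From mathcomp Require Import reals complex.

Set Implicit Arguments.
Unset Strict Implicit.
Unset Printing Implicit Defensive.

Import Order.TTheory GRing.Theory Num.Theory.
Local Open Scope classical_set_scope.
Local Open Scope ring_scope.

Section Laurent.
Variable K : fieldType.
Implicit Types f g h : int -> K^o.

(* [f n] is the coefficient of z ^ n. *)
Definition is_laurent : pred (int -> K^o) :=
  fun f => `[< exists a : int, forall n, n < a -> f n = 0 >].

Lemma is_laurentP f :
  reflect (exists a : int, forall n, n < a -> f n = 0) (f \in is_laurent).
Proof. exact: asboolP. Qed.

Lemma is_laurent_submod : subsemimod_closed is_laurent.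
Proof.
split; first split.
- by apply/is_laurentP; exists 0.
- move=> f g /is_laurentP[a fa] /is_laurentP[b gb].
  apply/is_laurentP; exists (Num.min a b) => n; rewrite lt_min => /andP[na nb].
  by rewrite /GRing.add/= fa// gb// addr0.
- move=> c f /is_laurentP[a fa]; apply/is_laurentP; exists a => n na.
  by rewrite /GRing.scale/= fa// scaler0.
Qed.

HB.instance Definition _ :=
  GRing.isSubmodClosed.Build K (int -> K^o) is_laurent is_laurent_submod.

Record laurent : Type := Laurent { lcoef :> int -> K^o; _ : lcoef \in is_laurent }.

HB.instance Definition _ := [isSub of laurent for lcoef].
HB.instance Definition _ := [Choice of laurent by <:].
HB.instance Definition _ := [SubChoice_isSubLmodule of laurent by <:].

(* For Laurent series the sum has finite support. *)
Definition lconv f g : int -> K^o :=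
  fun n => \sum_(k \in [set: int]) (f k * g (n - k) : K).

Let shift (a : int) f (m : nat) : {poly K} := \poly_(i < m) f (a + i%:Z).

Let conv_lt f g (a b n : int) :
  (forall m, m < a -> f m = 0) -> (forall m, m < b -> g m = 0) ->
  n < a + b -> lconv f g n = 0.
Proof.
move=> fa gb nab; apply: fsbig1 => k _.
case: (ltP k a) => ka; first by rewrite fa// mul0r.
by rewrite gb ?mulr0//; lia.
Qed.

Let conv_ge f g (a b : int) (m k : nat) :
  (forall m, m < a -> f m = 0) -> (forall m, m < b -> g m = 0) ->
  (k < m)%N -> lconv f g (a + b + k%:Z) = (shift a f m * shift b g m)`_k.
Proof.
move=> fa gb km.
rewrite coefM /lconv -(@fsbig_widen _ _ _ _
  [set` [seq a + i%:Z | i <- iota 0 k.+1]])//; last first.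
  move=> i [_ ni]; rewrite /preimage /=.
  case: (ltP i a) => ia; first by rewrite fa// mul0r.
  rewrite gb ?mulr0//; rewrite ltNge; apply/negP => ib; apply: ni.
  apply/(@mapP _ _ (fun j : nat => a + j%:Z)); exists (absz (i - a)%R); first by rewrite mem_iota; lia.
  lia.
rewrite -fsbig_seq ?map_inj_in_uniq ?iota_uniq//; last first.
  by move=> x y _ _ /addrI[].
rewrite big_map -[iota _ _]/(index_iota 0 k.+1) big_mkord.
apply: eq_bigr => i _; rewrite !coef_poly.
have ik := ltn_ord i.
rewrite (leq_trans ik km) (leq_ltn_trans _ km) ?leq_subr//.
by congr (_ * g _); lia.
Qed.

Let convE f1 g1 f2 g2 (a b c d : int) :
  (forall m, m < a -> f1 m = 0) -> (forall m, m < b -> g1 m = 0) ->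
  (forall m, m < c -> f2 m = 0) -> (forall m, m < d -> g2 m = 0) ->
  a + b = c + d ->
  (forall k, (shift a f1 k.+1 * shift b g1 k.+1)`_k =
             (shift c f2 k.+1 * shift d g2 k.+1)`_k) ->
  lconv f1 g1 = lconv f2 g2.
Proof.
move=> f1a g1b f2c g2d abcd H; apply/funext => n.
case: (ltP n (a + b)) => nab.
  by rewrite (conv_lt f1a g1b)// (conv_lt f2c g2d)// -abcd.
have -> : n = a + b + (absz (n - (a + b))%R)%:Z by lia.
by rewrite (conv_ge f1a g1b (ltnSn _)) abcd (conv_ge f2c g2d (ltnSn _)).
Qed.

Lemma conv_laurent f g :
  f \in is_laurent -> g \in is_laurent -> lconv f g \in is_laurent.
Proof.
move=> /is_laurentP[a fa] /is_laurentP[b gb]; apply/is_laurentP.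
by exists (a + b) => n; exact: conv_lt.
Qed.

Definition lmul (f g : laurent) : laurent :=
  Laurent (conv_laurent (valP f) (valP g)).

Lemma one_laurent : (fun n : int => (n == 0)%:R : K^o) \in is_laurent.
Proof.
by apply/is_laurentP; exists 0 => n n0; case: eqP n0 => // ->; rewrite ltxx.
Qed.

Definition lone : laurent := Laurent one_laurent.

Let lbound (f : laurent) : exists a : int, forall n, n < a -> f n = 0.
Proof. exact/is_laurentP/(valP f). Qed.

Let lmulA : associative lmul.
Proof.
move=> f g h; apply: val_inj => /=.
have [a fa] := lbound f; have [b gb] := lbound g; have [c hc] := lbound h.
apply: (@convE _ _ _ _ a (b + c) (a + b) c) => //.
- by move=> m; exact: conv_lt.
- by move=> m; exact: conv_lt.
- by rewrite addrA.
move=> k.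
have shconv (u v : int -> K^o) x y :
    (forall m, m < x -> u m = 0) -> (forall m, m < y -> v m = 0) ->
    forall i, (i <= k)%N -> (shift (x + y) (lconv u v) k.+1)`_i =
       (shift x u k.+1 * shift y v k.+1)`_i.
  by move=> ux vy i ik; rewrite coef_poly ltnS ik; exact: conv_ge.
transitivity ((shift a f k.+1 * (shift b g k.+1 * shift c h k.+1))`_k).
  rewrite !coefM; apply: eq_bigr => i _; congr (_ * _).
  by rewrite shconv// leq_subr.
rewrite mulrA !coefM; apply: eq_bigr => i _; congr (_ * _).
by rewrite shconv// -ltnS.
Qed.

Let lmulC : commutative lmul.
Proof.
move=> f g; apply: val_inj => /=.
have [a fa] := lbound f; have [b gb] := lbound g.
apply: (@convE _ _ _ _ a b b a) => //; first by rewrite addrC.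
by move=> k; rewrite mulrC.
Qed.

Let lmul1 : left_id lone lmul.
Proof.
move=> f; apply: val_inj; apply/funext => n /=.
rewrite /lconv -(@fsbig_widen _ _ _ _ [set 0])//.
  by rewrite fsbig_set1 eqxx mul1r subr0.
by move=> k [_ /= /eqP/negPf k0]; rewrite /preimage /= k0 mul0r.
Qed.

Let lmulDl : left_distributive lmul +%R.
Proof.
move=> f g h; apply: val_inj; apply/funext => n.
have [a fa] := lbound f; have [b gb] := lbound g; have [c hc] := lbound h.
pose d := Num.min a b.
have fd m : m < d -> f m = 0 by rewrite lt_min => /andP[+ _]; exact: fa.
have gd m : m < d -> g m = 0 by rewrite lt_min => /andP[_]; exact: gb.
have fgd m : m < d -> (f + g : laurent) m = 0.
  by move=> md; rewrite /= /GRing.add /= fd// gd// addr0.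
rewrite [LHS]/= [RHS]/= [RHS]/GRing.add /=.
case: (ltP n (d + c)) => ndc.
  by rewrite (conv_lt fgd hc)// (conv_lt fd hc)// (conv_lt gd hc)// addr0.
have -> : n = d + c + (absz (n - (d + c))%R)%:Z by lia.
rewrite (conv_ge fgd hc (ltnSn _)) (conv_ge fd hc (ltnSn _)).
rewrite (conv_ge gd hc (ltnSn _)); move: (absz _) => k.
suff -> : shift d (f + g : laurent) k.+1 = shift d f k.+1 + shift d g k.+1.
  by rewrite mulrDl coefD.
by apply/polyP => i; rewrite coefD !coef_poly; case: ifP; rewrite ?addr0.
Qed.

Let lone_neq0 : lone != 0.
Proof.
apply/eqP => /(congr1 (fun f : laurent => f 0)) /eqP.
exact/negP/oner_neq0.
Qed.

HB.instance Definition _ := GRing.Zmodule_isComNzRing.Build laurent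
  lmulA lmulC lmul1 lmulDl lone_neq0.

Let lscaleAl (c : K) (f g : laurent) : c *: (f * g) = (c *: f) * g.
Proof.
apply: val_inj; apply/funext => n /=.
have [a fa] := lbound f; have [b gb] := lbound g.
have cfa m : m < a -> (c *: f : laurent) m = 0.
  by move=> ma; rewrite /= /GRing.scale /= fa// scaler0.
rewrite [LHS]/GRing.scale /=.
case: (ltP n (a + b)) => nab.
  by rewrite (conv_lt fa gb)// (conv_lt cfa gb)// scaler0.
have -> : n = a + b + (absz (n - (a + b))%R)%:Z by lia.
rewrite (conv_ge fa gb (ltnSn _)) (conv_ge cfa gb (ltnSn _)).
move: (absz _) => k.
suff -> : shift a (c *: f : laurent) k.+1 = c *: shift a f k.+1.
  by rewrite -scalerAl coefZ.
by apply/polyP => i; rewrite coefZ !coef_poly; case: ifP; rewrite ?mulr0.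
Qed.

HB.instance Definition _ := GRing.Lmodule_isLalgebra.Build K laurent lscaleAl.
HB.instance Definition _ := GRing.Lalgebra_isComAlgebra.Build K laurent.

Lemma deriv_laurent f : f \in is_laurent ->
  (fun n : int => ((n + 1)%:~R * f (n + 1) : K) : K^o) \in is_laurent.
Proof.
move=> /is_laurentP[a fa]; apply/is_laurentP; exists (a - 1) => n na.
by rewrite fa ?mulr0// -ltrBrDr.
Qed.

(* d/dz : the coefficient of z ^ n in f' is (n + 1) f_(n + 1). *)
Definition lderiv (f : laurent) : laurent := Laurent (deriv_laurent (valP f)).

Definition is_diffop : pred (laurent -> laurent) := fun A =>
  `[< exists p : nat, exists w : nat -> laurent,
        A = (fun f : laurent => \sum_(j < p.+1) w j * iter j lderiv f) >].

Lemma is_diffopP (A : laurent -> laurent) :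
  reflect (exists p : nat, exists w : nat -> laurent,
             A = (fun f : laurent => \sum_(j < p.+1) w j * iter j lderiv f))
          (A \in is_diffop).
Proof. exact: asboolP. Qed.

Lemma is_diffop_submod : subsemimod_closed is_diffop.
Proof.
split; first split.
- apply/is_diffopP; exists 0%N, (fun=> 0); apply/funext => f.
  by rewrite big_ord1 mul0r.
- have pad (p q : nat) (w : nat -> laurent) (f : laurent) : (p <= q)%N ->
      \sum_(j < p.+1) w j * iter j lderiv f =
      \sum_(j < q.+1) (if (j <= p)%N then w j else 0) * iter j lderiv f.
    move=> pq; rewrite (big_ord_widen q.+1 (fun j => w j * iter j lderiv f))//.
    rewrite big_mkcond; apply: eq_bigr => j _; rewrite ltnS.
    by case: ifP => //; rewrite mul0r.
  move=> A B /is_diffopP[p [v ->]] /is_diffopP[q [w ->]].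
  apply/is_diffopP; exists (maxn p q).
  exists (fun j => (if (j <= p)%N then v j else 0) +
                   (if (j <= q)%N then w j else 0)).
  apply/funext => f; rewrite [LHS]/GRing.add /=.
  rewrite (pad p (maxn p q)) ?leq_maxl// (pad q (maxn p q)) ?leq_maxr//.
  by rewrite -big_split; apply: eq_bigr => j _; rewrite mulrDl.
- move=> c A /is_diffopP[p [w ->]]; apply/is_diffopP.
  exists p, (fun j => c *: w j); apply/funext => f.
  rewrite [LHS]/GRing.scale /= scaler_sumr.
  by apply: eq_bigr => j _; rewrite scalerAl.
Qed.

HB.instance Definition _ :=
  GRing.isSubmodClosed.Build K (laurent -> laurent) is_diffop is_diffop_submod.

(* Differential operators are taken as maps, equality being that of maps. *)
Record diffop : Type :=
  Diffop { diffop_fun :> laurent -> laurent; _ : diffop_fun \in is_diffop }.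

HB.instance Definition _ := [isSub of diffop for diffop_fun].
HB.instance Definition _ := [Choice of diffop by <:].
HB.instance Definition _ := [SubChoice_isSubLmodule of diffop by <:].

End Laurent.

Definition alt_comp (K : fieldType) (V : lmodType K) (N : nat)
    (A : 'I_N -> V -> V) : V -> V :=
  \sum_(s : 'S_N)
    ((-1) ^+ s : K) *: \big[(fun B C : V -> V => B \o C)/id]_(i < N) A (s i).

Section HomotopyLie.
Variables (K : numFieldType) (V : lmodType K) (N : nat).
Variable Delta : ('I_N -> V) -> V.

Definition set_arg (a : 'I_N -> V) (i : 'I_N) (x : V) : 'I_N -> V :=
  fun j => if j == i then x else a j.

Definition multilinear : Prop :=
  forall (a : 'I_N -> V) (i : 'I_N) (c : K) (u v : V),
    Delta (set_arg a i (c *: u + v)) =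
    c *: Delta (set_arg a i u) + Delta (set_arg a i v).

(* As 2 is invertible in K, this amounts to Delta being alternating, i.e. a map
   on the N-th exterior power of V. *)
Definition skew_symmetric : Prop :=
  forall (a : 'I_N -> V) (s : 'S_N),
    Delta (fun i => a (s i)) = ((-1) ^+ s : K) *: Delta a.

(* The argument list x, b_0, ..., b_(N-2), for N > 0. *)
Definition args_cons (x : V) (b : 'I_N.-1 -> V) : 'I_N -> V :=
  fun i => nth x (x :: codom b) i.

(* The index type 'I_(N + N.-1) has 2N - 1 elements, the first N of which are
   the [lshift _ i] and the last N - 1 of which are the [rshift _ i]. *)
Definition shuffle (s : 'S_(N + N.-1)) : bool :=
  [forall i : 'I_N, forall j : 'I_N,
     (i < j)%N ==> (s (lshift N.-1 i) < s (lshift N.-1 j))%N] &&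
  [forall i : 'I_N.-1, forall j : 'I_N.-1,
     (i < j)%N ==> (s (rshift N i) < s (rshift N j))%N].

Definition jacobi : Prop :=
  forall a : 'I_(N + N.-1) -> V,
    \sum_(s : 'S_(N + N.-1) | shuffle s) ((-1) ^+ s : K) *:
      Delta (args_cons (Delta (fun i => a (s (lshift N.-1 i))))
                       (fun i => a (s (rshift N i)))) = 0.

Definition homotopy_lie : Prop := [/\ multilinear, skew_symmetric & jacobi].

End HomotopyLie.

(* Main.v *)
Require Import Defs.
From HB Require Import structures.
From mathcomp Require Import boolp classical_sets functions cardinality fsbigop.
From mathcomp Require Import all_boot all_order all_fingroup all_algebra.
From mathcomp Require Import zify.
From mathcomp Require Import reals complex.

(** Two independent facts give the theorem.

    First, differential operators with Laurent coefficients are an associative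
    unital algebra under composition.  The point is closure: it reduces to
    closure under multiplication by a series and under composition with the
    derivation on the left, and the latter is the Leibniz rule [lderivM].  The
    bracket is then the standard polynomial [std_poly] of this algebra.

    Second, in any associative algebra the standard polynomial of even degree N
    satisfies the N-Jacobi identity ([std_poly_jacobi]).  Expand both brackets.
    A choice of a shuffle together with an order inside each of its two blocks
    is the same as an arbitrary permutation t of the 2N - 1 arguments
    ([sum_unshuffle]), so the Jacobi sum runs over t and over the number k of
    outer arguments standing to the left of the inner product, with sign
    (-1)^k times the sign of t ([std_poly_cons]).  For fixed k, the word so
    obtained is the product of all 2N - 1 arguments in the order given by t,
    up to carrying the inner block of N letters over k letters; as N is even,
    this is an even permutation ([even_block_move]), and the sum over t does
    not depend on k ([std_poly_block_move]).  There remains the alternating sum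
    of (-1)^k over 0 <= k < N, which vanishes since N is even. *)

Set Implicit Arguments.
Unset Strict Implicit.
Unset Printing Implicit Defensive.

Import Order.TTheory GRing.Theory Num.Theory.
Local Open Scope ring_scope.

(** * Ordered products with a distinguished factor *)

Lemma prod_codom (A : nzRingType) n (F : 'I_n -> A) :
  \prod_(i < n) F i = \prod_(y <- codom F) y.
Proof. by rewrite codomE big_map enumT. Qed.

Lemma enum_lift M (k : 'I_M.+1) :
  enum 'I_M.+1 =
  take k (map (lift k) (enum 'I_M)) ++ k :: drop k (map (lift k) (enum 'I_M)).
Proof.
have kM : (k <= M)%N by rewrite -ltnS.
apply: (inj_map val_inj); rewrite map_cat /= map_take map_drop -map_comp.
have -> : map (val \o lift k) (enum 'I_M) = map (bump k) (iota 0 M).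
  by rewrite -val_enum_ord -map_comp.
rewrite val_enum_ord -map_take -map_drop take_iota drop_iota.
rewrite (minn_idPl kM) add0n.
have -> : map (bump k) (iota 0 k) = iota 0 k.
  rewrite -[RHS]map_id; apply/eq_in_map => i; rewrite mem_iota /bump => /= ik.
  by rewrite leqNgt ik.
have -> : map (bump k) (iota k (M - k)) = iota k.+1 (M - k).
  rewrite -[k.+1]add1n iotaDl; apply/eq_in_map => i.
  by rewrite mem_iota /bump => /andP[-> _].
by rewrite -[RHS]/(iota 0 k ++ iota (0 + k) (M - k).+1) -iotaD addnS subnKC.
Qed.

Lemma prod_lift (A : nzRingType) M (k : 'I_M.+1) (F : 'I_M.+1 -> A) :
  \prod_(i < M.+1) F i =
  \prod_(y <- take k (codom (F \o lift k))) y * F k *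
  \prod_(y <- drop k (codom (F \o lift k))) y.
Proof.
rewrite prod_codom !codomE (enum_lift k) map_cat /= big_cat big_cons /= mulrA.
by rewrite map_take map_drop -map_comp.
Qed.

(** * Decompositions of permutations *)

(** Classifies a permutation t by the position k that it sends to 0: what is
    left of t is a permutation of the other positions. *)
Lemma sum_lift_perm (V : zmodType) M (F : 'S_M.+1 -> V) :
  \sum_t F t = \sum_(k < M.+1) \sum_(v : 'S_M) F (lift_perm k ord0 v).
Proof.
rewrite (partition_big (fun t : 'S_M.+1 => (t^-1)%g ord0) xpredT) //=.
apply: eq_bigr => k _.
pose rest (t : 'S_M.+1) j := odflt j (unlift ord0 (t (lift k j))).
have liftK (t : 'S_M.+1) j : (t^-1)%g ord0 = k ->
    lift ord0 (rest t j) = t (lift k j).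
  move=> tk; rewrite /rest; case: unliftP => [j' -> //| tj].
  by case/eqP: (neq_lift k j); rewrite -[RHS](permK t) tj tk.
have rest_inj (t : 'S_M.+1) : (t^-1)%g ord0 = k -> injective (rest t).
  move=> tk i j /(congr1 (lift ord0)); rewrite !liftK //.
  by move=> /perm_inj/lift_inj.
pose h (t : 'S_M.+1) :=
  if eqP is ReflectT tk then perm (rest_inj t tk) else 1%g.
rewrite (reindex (lift_perm k ord0)) /=; last first.
  exists h => [v _|t /eqP tk].
    apply/permP => j; rewrite /h; case: eqP => [e|[]].
      rewrite permE; apply: (@lift_inj _ ord0).
      by rewrite liftK // lift_perm_lift.
    by apply: (@perm_inj _ (lift_perm k ord0 v)); rewrite permKV lift_perm_id.
  apply/permP => j; rewrite /h; case: eqP => [e|//].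
  case: (unliftP k j) => [i ->|->].
    by rewrite lift_perm_lift permE liftK.
  by rewrite lift_perm_id -tk permKV.
apply: eq_bigl => v; apply/eqP.
by apply: (@perm_inj _ (lift_perm k ord0 v)); rewrite permKV lift_perm_id.
Qed.

Section Block.
Variables m n : nat.

Definition block_fun (u : 'S_m) (v : 'S_n) (i : 'I_(m + n)) : 'I_(m + n) :=
  unsplit (match split i with inl j => inl (u j) | inr j => inr (v j) end).

Lemma block_fun_inj u v : injective (block_fun u v).
Proof.
apply: (can_inj (g := block_fun u^-1 v^-1)) => i.
rewrite /block_fun unsplitK; case: splitP => j e /=;
  by rewrite permK; apply: val_inj.
Qed.

Definition block_perm u v : 'S_(m + n) := perm (@block_fun_inj u v).

Lemma block_perml u v i : block_perm u v (lshift n i) = lshift n (u i).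
Proof. by rewrite permE /block_fun (unsplitK (inl i)). Qed.

Lemma block_permr u v i : block_perm u v (rshift m i) = rshift m (v i).
Proof. by rewrite permE /block_fun (unsplitK (inr i)). Qed.

Lemma block_permV u v : ((block_perm u v)^-1 = block_perm u^-1 v^-1)%g.
Proof.
apply/permP => i; apply: (@perm_inj _ (block_perm u v)); rewrite permKV.
by case: (split_ordP i) => j ->;
  rewrite ?(block_perml, block_permr) permKV.
Qed.

(** The permutation matrix of [block_perm u v] is block diagonal, and the
    determinant of a permutation matrix is its sign. *)
Lemma odd_block_perm u v : block_perm u v = u (+) v :> bool.
Proof.
have : (-1) ^+ block_perm u v = (-1) ^+ (u (+) v) :> int.
  rewrite signr_addb -!det_perm -(det_ublock _ 0); congr (\det _).
  apply/matrixP => i j.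
  case: (split_ordP i) => i' ->; case: (split_ordP j) => j' ->;
    rewrite ?(block_mxEul, block_mxEur, block_mxEdl, block_mxEdr) !mxE;
    rewrite ?(block_perml, block_permr) ?eq_shift //.
by case: (odd_perm (block_perm u v)); case: (_ (+) _).
Qed.
End Block.

(** The permutation sorting an injective sequence is its rank function.  It is
    stated for the inverse of u because this is how the coset of a shuffle is
    parametrized in [sum_unshuffle]. *)
Lemma sorting_perm n m (f : 'I_n -> 'I_m) : injective f ->
  exists u0 : 'S_n, forall u : 'S_n,
    [forall i : 'I_n, forall j : 'I_n,
       (i < j)%N ==> (f (u^-1 i)%g < f (u^-1 j)%g)%N] = (u == u0).
Proof.
move=> f_inj; pose rank i := #|[set j | (f j < f i)%N]|.
have rankS i j : (f i < f j)%N -> (rank i < rank j)%N.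
  move=> ij; apply: proper_card; apply/properP; split.
    by apply/subsetP => x; rewrite !inE => /ltn_trans->.
  by exists i; rewrite !inE ?ltnn.
have rank_lt i : (rank i < n)%N.
  rewrite -[ltnRHS]card_ord -cardsT; apply: proper_card.
  rewrite properE subsetT.
  by apply/subsetPn; exists i; rewrite !inE ?ltnn.
have rank_inj : injective (fun i => Ordinal (rank_lt i)).
  move=> i j [] e; apply/f_inj/val_inj.
  by case: (ltngtP (f i) (f j)) => [/rankS|/rankS|//]; rewrite e ltnn.
exists (perm rank_inj) => u; apply/idP/eqP => [inc|->].
  apply/permP => i; rewrite permE; apply: val_inj => /=.
  have incE x y : (u x < u y)%N -> (f x < f y)%N.
    by move: inc => /forallP/(_ (u x))/forallP/(_ (u y))/implyP; rewrite !permK.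
  have -> : rank i = #|[set j | (u j < u i)%N]|.
    apply: eq_card => j; rewrite !inE; case: (ltngtP (u j) (u i)).
    - by move=> /incE.
    - by move=> /incE/ltnW; rewrite ltnNge => ->.
    - by move=> /val_inj/perm_inj->; rewrite ltnn.
  rewrite -(card_imset _ (@perm_inj _ u)).
  have -> : u @: [set j | (u j < u i)%N] = [set j : 'I_n | (j < u i)%N].
    apply/setP => j; apply/imsetP/idP => [[x + ->]|]; rewrite !inE // => ji.
    by exists (u^-1 j)%g; rewrite ?inE permKV.
  rewrite -sum1dep_card (big_ord_narrow (ltnW (ltn_ord _))).
  by rewrite sum1_card card_ord.
apply/forallP => i; apply/forallP => j; apply/implyP.
rewrite -{1}(permKV (perm rank_inj) i) -{1}(permKV (perm rank_inj) j).
move: ((perm rank_inj)^-1%g i) ((perm rank_inj)^-1%g j) => x y.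
rewrite !permE /= ltnNge; apply: contraR.
rewrite -leqNgt leq_eqVlt => /orP[/eqP/val_inj/f_inj->//|/rankS/ltnW //].
Qed.

(** Shuffles represent the cosets of the subgroup of block permutations: a
    permutation becomes a shuffle by sorting its values on each block, and
    sorting can be done in one way only. *)
Lemma sum_unshuffle (V : zmodType) N (H : 'S_(N + N.-1) -> V) :
  \sum_(s : 'S_(N + N.-1) | shuffle s) \sum_(u : 'S_N) \sum_(v : 'S_N.-1)
    H (block_perm u v * s)%g = \sum_t H t.
Proof.
under eq_bigr do rewrite pair_big /=.
rewrite exchange_big /=.
under eq_bigr => p _.
  rewrite (reindex_inj (mulgI (block_perm p.1 p.2)^-1%g)) /=.
  under eq_bigr do rewrite mulKVg.
  over.
rewrite (exchange_big_dep xpredT) //=; apply: eq_bigr => t _.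
have [] := @sorting_perm N _ (t \o @lshift N N.-1).
  by move=> i j /perm_inj/lshift_inj.
move=> u0 u0P.
have [] := @sorting_perm N.-1 _ (t \o @rshift N N.-1).
  by move=> i j /perm_inj/rshift_inj.
move=> v0 v0P.
rewrite (big_pred1 (u0, v0)) // => -[u v] /=; rewrite xpair_eqE -u0P -v0P.
rewrite /shuffle block_permV; congr (_ && _).
  apply: eq_forallb => i; apply: eq_forallb => j.
  by rewrite !permM !block_perml.
apply: eq_forallb => i; apply: eq_forallb => j.
by rewrite !permM !block_permr.
Qed.

(** The w given here reads N + M letters in the order where the first N are
    carried over the next k.  Passing from k to k + 1 moves the single letter in
    position k + N back to position k, i.e. over N letters; each such step is an
    even permutation because N is even. *)
Lemma even_block_move N M k : ~~ odd N -> (k <= M)%N ->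
  exists2 w : 'S_(N + M), ~~ odd_perm w &
    forall i, w i = (if i < k then N + i else if i < k + N then i - k else i)%N
                     :> nat.
Proof.
move=> evN.
(* M is made positive so that N + M is a successor, as [lift_perm] needs. *)
case: M => [|M].
  rewrite leqn0 => /eqP ->; exists 1%g => [|i]; first by rewrite odd_perm1.
  by rewrite perm1 /= subn0; case: ifP.
elim: k => [_|k IH kM].
  exists 1%g => [|i]; first by rewrite odd_perm1.
  by rewrite perm1 /= subn0; case: ifP.
have [w ew wE] := IH (ltnW kM).
have kNM : (k + N < N + M.+1)%N by lia.
have kM' : (k < N + M.+1)%N by lia.
move: w ew wE kNM kM'; rewrite addnS => w ew wE kNM kM'.
exists (lift_perm (Ordinal kM') (Ordinal kNM) 1 * w)%g.
  by rewrite odd_permM odd_lift_perm odd_perm1 /= oddD (negPf evN) !addbF addbb.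
move=> i; rewrite permM.
case: (unliftP (Ordinal kM') i) => [j ->|->]; last first.
  by rewrite lift_perm_id wE /= ltnNge leq_addr /= ltnn ltnSn addnC.
rewrite lift_perm_lift perm1 wE /= /bump.
move: {j}(nat_of_ord j) => j.
by case: (leqP k j) => ?; case: (leqP (k + N) j) => ? /=;
  do 4?case: ifP => ?; lia.
Qed.

Lemma enum_block_move N M k (w : 'S_(N + M)) : (k <= M)%N ->
  (forall i, w i = (if i < k then N + i else if i < k + N then i - k else i)%N
                   :> nat) ->
  map w (enum 'I_(N + M)) =
  take k (map (@rshift N M) (enum 'I_M)) ++ map (@lshift N M) (enum 'I_N) ++
  drop k (map (@rshift N M) (enum 'I_M)).
Proof.
move=> kM wE; apply: (inj_map val_inj).
rewrite !map_cat map_take map_drop.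
have -> : map val (map (@lshift N M) (enum 'I_N)) = iota 0 N.
  by rewrite -val_enum_ord -map_comp; apply: eq_map.
have -> : map val (map (@rshift N M) (enum 'I_M)) = iota N M.
  by rewrite -[N in RHS]addn0 iotaDl -val_enum_ord -!map_comp; apply: eq_map.
rewrite -map_comp (eq_map (g := (fun i => if i < k then N + i else
  if i < k + N then i - k else i)%N \o val)) //.
rewrite map_comp val_enum_ord take_iota drop_iota (minn_idPl kM).
have -> : (N + M = k + (N + (M - k)))%N by lia.
rewrite !iotaD !map_cat add0n; congr (_ ++ (_ ++ _)).
- rewrite -[N in RHS]addn0 iotaDl; apply/eq_in_map => i.
  by rewrite mem_iota /= add0n => ->.
- rewrite -[k in iota k]addn0 iotaDl -map_comp -[RHS]map_id.
  apply/eq_in_map => i.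
  by rewrite mem_iota /= => ?; do 2?case: ifP => ?; lia.
- rewrite addnC -[RHS]map_id; apply/eq_in_map => i.
  by rewrite mem_iota /= => /andP[? ?]; do 2?case: ifP => ?; lia.
Qed.

(** * Standard polynomials of an algebra *)

Lemma sum_signs (K : nzRingType) n : \sum_(k < n) (-1) ^+ k = (odd n)%:R :> K.
Proof.
elim: n => [|n IH]; first by rewrite big_ord0.
by rewrite big_ord_recr /= IH -signr_odd; case: (odd n); rewrite ?subrr ?add0r.
Qed.

Section StandardPolynomial.
Variables (K : numFieldType) (A : algType K).

Definition std_poly N (a : 'I_N -> A) : A :=
  \sum_(s : 'S_N) ((-1) ^+ s : K) *: \prod_(i < N) a (s i).

Definition prod_before k N (b : 'I_N -> A) := \prod_(y <- take k (codom b)) y.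
Definition prod_after k N (b : 'I_N -> A) := \prod_(y <- drop k (codom b)) y.

Lemma eq_prod_before k N (b c : 'I_N -> A) :
  b =1 c -> prod_before k b = prod_before k c.
Proof. by rewrite /prod_before => /eq_codom ->. Qed.

Lemma eq_prod_after k N (b c : 'I_N -> A) :
  b =1 c -> prod_after k b = prod_after k c.
Proof. by rewrite /prod_after => /eq_codom ->. Qed.

Lemma std_poly_multilinear N : multilinear (@std_poly N).
Proof.
case: N => [|N] a i c u v; first by case: i.
pose rest (s : 'S_N.+1) j := a (s (lift ((s^-1)%g i) j)).
have E x (s : 'S_N.+1) : \prod_(j < N.+1) set_arg a i x (s j) =
    prod_before ((s^-1)%g i) (rest s) * x * prod_after ((s^-1)%g i) (rest s).
  rewrite (prod_lift ((s^-1)%g i)) {2}/set_arg permKV eqxx.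
  rewrite /prod_before /prod_after.
  suff -> : codom ((fun j => set_arg a i x (s j)) \o lift ((s^-1)%g i)) =
            codom (rest s) by [].
  apply: eq_codom => j; rewrite /= /set_arg -[X in _ == X](permKV s i).
  by rewrite (inj_eq perm_inj) eq_sym (negPf (neq_lift _ _)).
rewrite /std_poly scaler_sumr -big_split /=; apply: eq_bigr => s _.
rewrite !E mulrDr mulrDl scalerDr -scalerAr -scalerAl !scalerA.
by rewrite (mulrC c).
Qed.

Lemma std_poly_skew N : skew_symmetric (@std_poly N).
Proof.
move=> a s; rewrite /std_poly (reindex_inj (mulIg s^-1%g)) scaler_sumr.
apply: eq_bigr => t _.
rewrite odd_permM odd_permV signr_addb scalerA mulrC; congr (_ *: _).
by apply: eq_bigr => i _; rewrite permM permKV.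
Qed.

(** Expansion of the outer bracket according to the number k of arguments
    standing to the left of x; carrying x from the front to there costs
    (-1)^k. *)
Lemma std_poly_cons M x (b : 'I_M -> A) :
  std_poly (@args_cons _ A M.+1 x b) =
  \sum_(k < M.+1) ((-1) ^+ k : K) *: \sum_(v : 'S_M) ((-1) ^+ v : K) *:
    (prod_before k (b \o v) * x * prod_after k (b \o v)).
Proof.
rewrite /std_poly sum_lift_perm; apply: eq_bigr => k _.
rewrite scaler_sumr; apply: eq_bigr => v _.
rewrite odd_lift_perm /= addbF signr_addb signr_odd scalerA; congr (_ *: _).
rewrite (prod_lift k) lift_perm_id {2}/args_cons /=.
suff -> : codom ((fun i => @args_cons _ A M.+1 x b (lift_perm k ord0 v i))
                 \o lift k) = codom (b \o v) by [].
apply: eq_codom => j; rewrite /= lift_perm_lift /args_cons /=.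
rewrite codomE (nth_map (v j)) ?size_enum_ord; last exact: (ltn_ord (v j)).
by congr b; apply: nth_ord_enum.
Qed.

(** The left-hand side seems to depend on k; carrying the block of N letters
    back to the front is an even permutation of all the letters, and it is
    absorbed by the alternating sum. *)
Lemma std_poly_block_move N M k (a : 'I_(N + M) -> A) :
  ~~ odd N -> (k <= M)%N ->
  \sum_(t : 'S_(N + M)) ((-1) ^+ t : K) *:
    (prod_before k (fun j => a (t (rshift N j))) *
     \prod_(i < N) a (t (lshift M i)) *
     prod_after k (fun j => a (t (rshift N j)))) = std_poly a.
Proof.
move=> evN kM; have [w ew wE] := even_block_move evN kM.
rewrite /std_poly [RHS](reindex_inj (mulgI w)) /=; apply: eq_bigr => t _.
rewrite odd_permM (negPf ew); congr (_ *: _).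
under [RHS]eq_bigr do rewrite permM.
rewrite 2!prod_codom /prod_before /prod_after !codomE.
rewrite (map_comp (fun i => a (t i)) w) (enum_block_move kM wE).
rewrite !map_cat !big_cat /= mulrA map_take map_drop.
by rewrite -!map_comp.
Qed.

(** Each word occurs once for each position k of the inner block, with a sign
    proportional to (-1)^k, hence cancels. *)
Lemma std_poly_jacobi N : (0 < N)%N -> ~~ odd N -> jacobi (@std_poly N).
Proof.
case: N => // M _ evN a.
pose H k (t : 'S_(M.+1 + M)) := ((-1) ^+ t : K) *:
    (prod_before k (fun j => a (t (rshift M.+1 j))) *
     \prod_(i < M.+1) a (t (lshift M i)) *
     prod_after k (fun j => a (t (rshift M.+1 j)))).
transitivity (\sum_(k < M.+1) ((-1) ^+ k : K) *:
   \sum_(s | @shuffle M.+1 s) \sum_(u : 'S_M.+1) \sum_(v : 'S_M)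
     H k (block_perm u v * s)%g).
  under [RHS]eq_bigr do rewrite scaler_sumr.
  rewrite [RHS]exchange_big; apply: eq_bigr => s _.
  rewrite std_poly_cons scaler_sumr; apply: eq_bigr => k _.
  rewrite scalerA mulrC -scalerA; congr (_ *: _).
  rewrite [RHS]exchange_big scaler_sumr; apply: eq_bigr => v _.
  rewrite [in LHS]/std_poly mulr_sumr mulr_suml !scaler_sumr.
  apply: eq_bigr => u _; rewrite /H odd_permM odd_block_perm !signr_addb.
  rewrite -scalerAr -scalerAl !scalerA.
  congr (_ *: (_ * _ * _)).
  - by rewrite mulrC [X in _ * X]mulrC mulrA.
  - by apply: eq_prod_before => j /=; rewrite permM block_permr.
  - by apply: eq_bigr => i _; rewrite permM block_perml.
  - by apply: eq_prod_after => j /=; rewrite permM block_permr.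
under eq_bigr => k _.
  rewrite (@sum_unshuffle _ M.+1) std_poly_block_move -1?ltnS //.
  over.
by rewrite -scaler_suml sum_signs (negPf evN) scale0r.
Qed.
End StandardPolynomial.

(** * Laurent series and the Leibniz rule *)

Section DiffopAlgebra.
Variable K : fieldType.
Implicit Types (f g : laurent K) (A B : laurent K -> laurent K).

Lemma laurent_bounded f : exists a : int, forall n, n < a -> f n = 0.
Proof. exact/is_laurentP/(valP f). Qed.

Lemma laurent_ext f g : (forall n, f n = g n) -> f = g.
Proof. by move=> fg; apply/val_inj/funext. Qed.

(** For series starting at a and at b, the convolution at n has no term of
    index above n - b, hence is a sum of m terms for any m > n - a - b.  Leaving
    m free lets the three products of the Leibniz rule, whose lower bounds
    differ by one, be written with the same number of terms. *)
Lemma coef_laurentM f g (a b n : int) (m : nat) :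
  (forall k, k < a -> f k = 0) -> (forall k, k < b -> g k = 0) ->
  n < a + b + m%:Z ->
  (f * g) n = \sum_(i < m) (f (a + i%:Z) * g (n - (a + i%:Z)) : K) :> K.
Proof.
move=> fa gb nm; rewrite [LHS]/(lconv _ _ _) /lconv.
rewrite -(@fsbig_widen _ _ _ _ [set` [seq a + i%:Z | i <- iota 0 m]]) //.
  rewrite -fsbig_seq; last first.
    by rewrite map_inj_uniq ?iota_uniq // => i j /addrI[].
  by rewrite big_map -[m in iota _ m]subn0 big_mkord.
move=> i [_ ni]; rewrite /preimage /=.
case: (ltP i a) => ia; first by rewrite fa ?mul0r.
rewrite gb ?mulr0 //; rewrite ltNge; apply/negP => ib; apply: ni => /=.
by apply/mapP; exists (absz (i - a)); rewrite ?mem_iota; lia.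
Qed.

(** Coefficients live in the regular module K^o; the type annotations here move
    equations about them to the field K, where the ring lemmas rewrite. *)
Lemma coefD_laurent f g n : (f + g) n = (f n : K) + g n :> K.
Proof. by []. Qed.

Lemma coef_lderiv f n : lderiv f n = (n + 1)%:~R * (f (n + 1) : K) :> K.
Proof. by []. Qed.

(** With the bound of the differentiated factor lowered by one, the three
    coefficients at n are sums over the same products
    f_(a + i) g_(n + 1 - a - i), weighted by
    n + 1 = (a + i) + (n + 1 - a - i). *)
Lemma lderivM f g : lderiv (f * g) = lderiv f * g + f * lderiv g.
Proof.
have [a fa] := laurent_bounded f; have [b gb] := laurent_bounded g.
have dfa k : k < a - 1 -> lderiv f k = 0.
  by move=> ka; rewrite /= fa ?mulr0 //; lia.
have dgb k : k < b - 1 -> lderiv g k = 0.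
  by move=> kb; rewrite /= gb ?mulr0 //; lia.
apply: laurent_ext => n; rewrite coefD_laurent coef_lderiv.
(* The smallest m fitting all three products is n + 2 - a - b, or 0 if that is
   negative; the absolute value is at least this. *)
pose m := absz (n + 2 - a - b)%R.
rewrite (@coef_laurentM _ _ _ _ _ m dfa gb); last by lia.
rewrite (@coef_laurentM _ _ _ _ _ m fa dgb); last by lia.
rewrite (@coef_laurentM _ _ _ _ _ m fa gb); last by lia.
rewrite mulr_sumr -big_split; apply: eq_bigr => i _; rewrite !coef_lderiv.
have -> : a - 1 + i%:Z + 1 = a + i%:Z by lia.
have -> : n - (a - 1 + i%:Z) = n + 1 - (a + i%:Z) by lia.
have -> : n - (a + i%:Z) + 1 = n + 1 - (a + i%:Z) by lia.
have {1}-> : n + 1 = (a + i%:Z) + (n + 1 - (a + i%:Z)) by lia.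
rewrite intrD; move: (f _) (g _) => x y.
by rewrite mulrDl mulrA mulrCA.
Qed.

Lemma lderiv_is_linear : linear (@lderiv K).
Proof.
move=> c f g; apply: laurent_ext => n.
by rewrite /= mulrDr mulrCA.
Qed.

HB.instance Definition _ :=
  GRing.isLinear.Build K (laurent K) (laurent K) _ (@lderiv K) lderiv_is_linear.

(** * The algebra of differential operators *)

Lemma diffop_monomial w j :
  (fun f : laurent K => w * iter j (@lderiv K) f) \in @is_diffop K.
Proof.
apply/is_diffopP; exists j, (fun i => if i == j then w else 0).
apply/funext => f; rewrite big_ord_recr /= eqxx big1 ?add0r // => i _.
by rewrite (ltn_eqF (ltn_ord i)) mul0r.
Qed.

Lemma is_diffop_ind (P : (laurent K -> laurent K) -> Prop) :
  P 0 -> (forall A B, P A -> P B -> P (A + B)) ->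
  (forall w j, P (fun f => w * iter j (@lderiv K) f)) ->
  forall A, A \in @is_diffop K -> P A.
Proof.
move=> P0 PD Pm A /is_diffopP[p [w ->]].
have -> : (fun f => \sum_(j < p.+1) w j * iter j (@lderiv K) f) =
   \sum_(j < p.+1) (fun f => w j * iter j (@lderiv K) f).
  by apply/funext => f; rewrite fct_sumE.
exact: big_ind.
Qed.

Lemma diffop_mull w A : A \in @is_diffop K ->
  (fun f => w * A f) \in @is_diffop K.
Proof.
elim/is_diffop_ind: A / => [|A B IA IB|v j].
- under eq_fun do rewrite mulr0; exact: rpred0.
- under eq_fun do rewrite mulrDr; exact: rpredD.
- under eq_fun do rewrite mulrA; exact: diffop_monomial.
Qed.

(** By the Leibniz rule, d o (v d^j) = v' d^j + v d^(j+1). *)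
Lemma diffop_deriv A : A \in @is_diffop K -> (@lderiv K) \o A \in @is_diffop K.
Proof.
elim/is_diffop_ind: A / => [|A B IA IB|v j].
- have -> : @lderiv K \o 0 = (0 : laurent K -> laurent K).
    by apply/funext => f; apply: raddf0.
  exact: rpred0.
- have -> : @lderiv K \o (A + B) = (@lderiv K \o A) + (@lderiv K \o B).
    by apply/funext => f; apply: raddfD.
  exact: rpredD.
- have -> : @lderiv K \o (fun f => v * iter j (@lderiv K) f) =
            (fun f => lderiv v * iter j (@lderiv K) f) +
            (fun f => v * iter j.+1 (@lderiv K) f).
    by apply/funext => f; apply: lderivM.
  by apply: rpredD; apply: diffop_monomial.
Qed.

Lemma diffop_comp A B :
  A \in @is_diffop K -> B \in @is_diffop K -> A \o B \in @is_diffop K.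
Proof.
move=> + dB; elim/is_diffop_ind: A / => [|A A' IA IA'|w j].
- exact: rpred0.
- exact: (rpredD IA IA').
- apply: (@diffop_mull w (fun f => iter j (@lderiv K) (B f))).
  by elim: j => [//|j IH]; apply: diffop_deriv.
Qed.

Lemma diffop_linear A : A \in @is_diffop K -> linear A.
Proof.
elim/is_diffop_ind: A / => [|A B IA IB|w j] c f g.
- by rewrite scaler0 addr0.
- have addE h : (A + B) h = A h + B h by [].
  by rewrite !addE IA IB addrACA -scalerDr.
- have -> : iter j (@lderiv K) (c *: f + g) =
            c *: iter j (@lderiv K) f + iter j (@lderiv K) g.
    by elim: j => //= j ->; rewrite linearP.
  by rewrite mulrDr scalerAr.
Qed.

Lemma diffop_id : id \in @is_diffop K.
Proof.
by have := diffop_monomial 1 0; under eq_fun do rewrite mul1r.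
Qed.

Definition diffop_one : diffop K := Diffop diffop_id.
Definition diffop_mul (A B : diffop K) : diffop K :=
  Diffop (diffop_comp (valP A) (valP B)).

Fact diffop_mulA : associative diffop_mul.
Proof. by move=> A B C; apply: val_inj. Qed.
Fact diffop_mul1l : left_id diffop_one diffop_mul.
Proof. by move=> A; apply: val_inj. Qed.
Fact diffop_mul1r : right_id diffop_one diffop_mul.
Proof. by move=> A; apply: val_inj. Qed.
Fact diffop_mulDl : left_distributive diffop_mul +%R.
Proof. by move=> A B C; apply: val_inj. Qed.
Fact diffop_mulDr : right_distributive diffop_mul +%R.
Proof.
move=> A B C; apply/val_inj/funext => f /=.
by have := diffop_linear (valP A) 1 (B f) (C f); rewrite !scale1r.
Qed.
Fact diffop_one_neq0 : diffop_one != 0.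
Proof.
apply/eqP => /(congr1 (fun A : diffop K => A 1)) /eqP.
exact/negP/oner_neq0.
Qed.

HB.instance Definition _ := GRing.Zmodule_isNzRing.Build (diffop K)
  diffop_mulA diffop_mul1l diffop_mul1r diffop_mulDl diffop_mulDr
  diffop_one_neq0.

Fact diffop_scalerAl (c : K) (A B : diffop K) : c *: (A * B) = c *: A * B.
Proof. exact: val_inj. Qed.
Fact diffop_scalerAr (c : K) (A B : diffop K) : c *: (A * B) = A * (c *: B).
Proof.
apply/val_inj/funext => f /=; apply/esym.
have A0 : val A 0 = 0.
  have := diffop_linear (valP A) (-1) 0 0.
  by rewrite scaler0 addr0 scaleN1r addNr.
by have := diffop_linear (valP A) c (B f) 0; rewrite A0 !addr0.
Qed.

HB.instance Definition _ :=
  GRing.Lmodule_isLalgebra.Build K (diffop K) diffop_scalerAl.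
HB.instance Definition _ :=
  GRing.Lalgebra_isAlgebra.Build K (diffop K) diffop_scalerAr.
End DiffopAlgebra.

Lemma diffop_fun_std_poly (K : numFieldType) N (A : 'I_N -> diffop K) :
  diffop_fun (std_poly A) = alt_comp (fun i => diffop_fun (A i)).
Proof.
rewrite /alt_comp -[LHS]/(val (std_poly A)) raddf_sum; apply: eq_bigr => s _.
transitivity (((-1) ^+ s : K) *: diffop_fun (\prod_(i < N) A (s i))) => //.
congr (_ *: _).
exact: (big_morph (@diffop_fun K)).
Qed.

Theorem theorem9 (R : realType) (N : nat) (hN : (2 <= N)%N) (evenN : ~~ odd N) :
  exists2 Delta : ('I_N -> diffop R[i]) -> diffop R[i],
    (forall A : 'I_N -> diffop R[i],
       diffop_fun (Delta A) = alt_comp (fun i => diffop_fun (A i))) &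
    homotopy_lie Delta.
Proof.
exists (@std_poly R[i] (diffop R[i]) N); first exact: diffop_fun_std_poly.
split; [exact: std_poly_multilinear | exact: std_poly_skew |].
by apply: std_poly_jacobi => //; apply: ltnW.
Qed.
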